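(* Let $A(t)\in\mathbb{R}^{n\times n}$, $G(t)\in\mathbb{R}^{n\times m}$, $C(t)\in\mathbb{R}^{p\times n}$ and $H(t)$ (with $p$ rows) be matrices depending smoothly on $t$, with $A(t)$ and $H(t)H(t)'$ invertible for all $t$. Consider the Riccati differential equation on the cone $P_+(n)$ of symmetric positive definite $n\times n$ matrices $$\frac{d}{dt}P=A(t)P+PA(t)'+G(t)G(t)'-PC(t)'(H(t)H(t)')^{-1}C(t)P .$$ Assume that $G(t)G(t)'$ is positive definite for all $t$. Then this equation is a contraction for the natural metric $g_P(Y_1,Y_2)=\mathrm{Tr}(P^{-1}Y_1P^{-1}Y_2)$ of $P_+(n)$, and at each $P$ the contraction rate can be taken to be $\lambda=\mu/p_{\max}$, where $\mu>0$ is a lower bound on the eigenvalues of $GG'$ and $p_{\max}$ is an upper bound on the eigenvalues of $P$. That is, for every solution $P(t)$ of the equation in $P_+(n)$ and every solution $\delta P(t)$ (with values in symmetric matrices) of the equation linearized along $P(t)$, at every time $t$ at which all eigenvalues of $P(t)$ are at most $p_{\max}$ and all eigenvalues of $G(t)G(t)'$ are at least $\mu$, one has $$\frac{d}{dt}\,g_{P(t)}(\delta P(t),\delta P(t))\le -2\,\frac{\mu}{p_{\max}}\,g_{P(t)}(\delta P(t),\delta P(t)).$$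
   Context: $M'$ denotes the transpose of a matrix $M$. $P_+(n)$ is the open cone of symmetric positive definite $n\times n$ real matrices; its tangent space at each point is the space of symmetric $n\times n$ matrices. Contraction: let $\frac{d}{dt}x=f(x,t)$ be a smooth dynamical system on a Riemannian manifold $(M,g)$ with flow $X(x,t)$, $X(x,0)=x$. The system is called a contraction on $N\subset M$ if there is $\lambda\ge 0$ such that infinitesimal displacements transported by the flow satisfy $\frac{d}{dt}\,g(\delta X,\delta X)\le -2\lambda\, g(\delta X,\delta X)$ at points of $N$, where $\delta X=\frac{d}{ds}X(\sigma(s),t)$ for $\sigma$ a geodesic emanating from a point $x$ with arbitrary direction $v\in T_xM$, and $g$ is evaluated at $X(\sigma(s),t)$. Equivalently, $\delta X$ is any solution of the equation linearized along a solution. The contraction is strict if $\lambda>0$. *)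

(* Defs.v *)
From HB Require Import structures.
From mathcomp Require Export all_boot all_order all_algebra.
From mathcomp Require Export all_classical all_reals all_analysis.
Export Order.TTheory GRing.Theory Num.Theory.
Export numFieldNormedType.Exports.

Set Implicit Arguments.
Unset Strict Implicit.
Unset Printing Implicit Defensive.

Local Open Scope classical_set_scope.
Local Open Scope ring_scope.

(* A system dx/dt = f t x on a manifold M given as an open subset of a linear
   subspace T of a normed space V, so that the tangent space is T at every
   point; g x is the inner product on T at the point x. *)
Section Contraction.
Context {R : realType} {V : normedModType R}.
Implicit Types (M T N : set V) (f : R -> V -> V) (g : V -> V -> V -> R).
Implicit Types (J : set R) (x dx : R -> V).

Definition smooth x := forall (k : nat) (t : R), derivable (derive1n k x) t 1.

Definition solution_on M f J x := forall t, J t ->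
  M (x t) /\ is_derive t (1 : R) x (f t (x t)).

Definition linearized_solution_on T f J x dx := forall t, J t ->
  T (dx t) /\ is_derive t (1 : R) dx ('d (f t) (x t) (dx t)).

(* The derivability clause is needed because derive1 is total. *)
Definition contracts_at g lambda x dx t :=
  let e := fun s => g (x s) (dx s) (dx s) in
  derivable e t 1 /\ derive1 e t <= - (2 * lambda) * e t.

(* The displacements are the solutions of the equation linearized along a
   solution. Solutions live on arbitrary open intervals J, since they need not
   be global in time. *)
Definition contraction_on M T f g N := exists2 lambda : R, 0 <= lambda &
  forall J x dx, open J -> is_interval J ->
    solution_on M f J x -> linearized_solution_on T f J x dx ->
    forall t, J t -> N (x t) -> contracts_at g lambda x dx t.

End Contraction.

Section Riccati.
Context {R : realType} {n : nat}.

Definition symmetric_mx : set 'M[R]_n := [set M | M^T = M].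

Definition posdef : set 'M[R]_n := [set M | symmetric_mx M /\
  forall u : 'cV[R]_n, u != 0 -> 0 < (u^T *m M *m u) 0 0].

Definition riccati m p q (A : R -> 'M[R]_n) (G : R -> 'M[R]_(n, m))
    (C : R -> 'M[R]_(p, n)) (H : R -> 'M[R]_(p, q)) (t : R) (P : 'M[R]_n) :=
  A t *m P + P *m (A t)^T + G t *m (G t)^T
  - P *m (C t)^T *m invmx (H t *m (H t)^T) *m C t *m P.

Definition natural_metric (P Y1 Y2 : 'M[R]_n) : R :=
  \tr (invmx P *m Y1 *m invmx P *m Y2).

End Riccati.

(* Main.v *)
Require Import Defs.
From mathcomp Require Import ring lra.

(* Write Q = P^-1, W = GG', S = C'(HH')^-1 C and D for the displacement. Along
   the flow the terms in A cancel by cyclicity of the trace, and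
     d/dt Tr(QDQD) = - 2 Tr(WX) - 2 Tr(S DQD),   X = QDQDQ = (QD)Q(QD)'.
   A Cholesky factor of Q turns both traces into sums of values of quadratic
   forms, so the second one is nonnegative. By the Rayleigh quotient, the
   eigenvalue bounds make W - mu and p_max - P positive semidefinite, whence
   Tr(WX) >= mu Tr(X) and Tr(QDQD) = Tr(PX) <= p_max Tr(X). *)

Local Open Scope classical_set_scope.
Local Open Scope ring_scope.

Set Implicit Arguments.
Unset Strict Implicit.
Unset Printing Implicit Defensive.

(** * Derivatives of matrix-valued functions *)

Section MatrixCalculus.
Context {R : realType} {V : normedModType R}.

Lemma is_derive_mxP m n (f : V -> 'M[R]_(m, n)) x v df :
  is_derive x v f df <-> forall i j, is_derive x v (fun y => f y i j) (df i j).
Proof.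
split=> [[fx <-] i j|fij].
  apply: DeriveDef; first exact: (derivable_mxP f x v).1.
  by rewrite derive_mx // mxE.
have fx : derivable f x v by apply/derivable_mxP => i j; have [] := fij i j.
apply: DeriveDef => //; rewrite derive_mx //; apply/matrixP => i j.
by rewrite mxE; have [] := fij i j.
Qed.

Lemma is_derive_fsum (I : Type) (r : seq I) (F : I -> V -> R) (dF : I -> R)
    x v :
  (forall i, is_derive x v (F i) (dF i)) ->
  is_derive x v (fun y => \sum_(i <- r) F i y) (\sum_(i <- r) dF i).
Proof.
move=> Fx; elim: r => [|i r IH].
  rewrite big_nil (_ : (fun _ => _) = cst 0); last first.
    by apply/funext => y; rewrite big_nil.
  exact: is_derive_cst.
rewrite big_cons (_ : (fun _ => _) = F i + (fun y => \sum_(i <- r) F i y)).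
  exact: is_deriveD.
by apply/funext => y; rewrite big_cons.
Qed.

Lemma derivable_fprod (I : Type) (r : seq I) (F : I -> V -> R) x v :
  (forall i, derivable (F i) x v) ->
  derivable (fun y => \prod_(i <- r) F i y) x v.
Proof.
move=> Fx; elim: r => [|i r IH].
  rewrite (_ : (fun _ => _) = cst 1); last first.
    by apply/funext => y; rewrite big_nil.
  exact: derivable_cst.
rewrite (_ : (fun _ => _) = F i * (fun y => \prod_(i <- r) F i y)).
  exact: derivableM.
by apply/funext => y; rewrite big_cons.
Qed.

Lemma is_derive_mulmx m n p (f : V -> 'M[R]_(m, n)) (g : V -> 'M[R]_(n, p))
    x v df dg :
  is_derive x v f df -> is_derive x v g dg ->
  is_derive x v (fun y => f y *m g y) (df *m g x + f x *m dg).
Proof.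
move=> /is_derive_mxP fx /is_derive_mxP gx; apply/is_derive_mxP => i j.
rewrite (_ : (fun _ => _) = fun y => \sum_k f y i k * g y k j); last first.
  by apply/funext => y; rewrite mxE.
rewrite !mxE -big_split /=; apply: is_derive_fsum => k.
have h := is_deriveM (fx i k) (gx k j).
rewrite (_ : _ + _ = f x i k *: dg k j + g x k j *: df i k) //.
by rewrite /GRing.scale /=; ring.
Qed.

Lemma is_derive_mxtrace n (f : V -> 'M[R]_n) x v df :
  is_derive x v f df -> is_derive x v (fun y => \tr (f y)) (\tr df).
Proof. by move=> /is_derive_mxP fx; apply: is_derive_fsum. Qed.

Lemma derivable_det n (f : V -> 'M[R]_n) x v :
  derivable f x v -> derivable (fun y => \det (f y)) x v.
Proof.
move=> /derivable_mxP fx; rewrite /determinant.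
apply: (@ex_derive _ _ _ _ _ _ _ (is_derive_fsum _ _)) => s.
apply: derivableP; apply: derivableM; first exact: derivable_cst.
by apply: derivable_fprod => i; exact: fx.
Qed.

Lemma derivable_adj n (f : V -> 'M[R]_n) x v :
  derivable f x v -> derivable (fun y => \adj (f y)) x v.
Proof.
move=> /derivable_mxP fx; apply/derivable_mxP => i j.
rewrite (_ : (fun _ => _) =
  cst ((-1) ^+ (j + i)) * fun y => \det (row' j (col' i (f y)))); last first.
  by apply/funext => y; rewrite mxE.
apply: derivableM; first exact: derivable_cst.
apply/derivable_det/derivable_mxP => k l.
by under eq_fun do rewrite !mxE; exact: fx.
Qed.

(** The cofactor formula gives derivability of the inverse; its derivative is then found by
    differentiating [f y *m invmx (f y) = 1%:M]. *)
Lemma is_derive_invmx n (f : V -> 'M[R]_n) x v df :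
  (\forall y \near x, f y \in unitmx) -> is_derive x v f df ->
  is_derive x v (fun y => invmx (f y)) (- (invmx (f x) *m df *m invmx (f x))).
Proof.
move=> funit fx; have fxu : f x \in unitmx by exact: nbhs_singleton funit.
have ifx : derivable (fun y => invmx (f y)) x v.
  (* The cofactor formula for [invmx] holds only on [unitmx], outside of which [invmx] is the
     identity map; hence an equality near [x] only. *)
  apply: (near_eq_derivable (f := fun y => (\det (f y))^-1 *: \adj (f y))).
    by near=> y; rewrite /invmx ifT //; near: y.
  apply/derivable_mxP => i j.
  rewrite (_ : (fun _ => _) =
    (fun y => (\det (f y))^-1) * fun y => \adj (f y) i j).
    apply: derivableM.
      apply: derivableV; first by rewrite -unitfE -unitmxE.
      exact/derivable_det/ex_derive.
    by move/derivable_mxP : (derivable_adj (@ex_derive _ _ _ _ _ _ _ fx)).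
  by apply/funext => y; rewrite mxE.
apply: DeriveDef => //; set dg := 'D_v _ x.
have [_ d1] := is_derive_mulmx fx (derivableP ifx).
have : 'D_v (fun y => f y *m invmx (f y)) x = 0.
  rewrite (near_eq_derive (g := cst 1%:M)) ?derive_cst //.
  by near=> y; rewrite mulmxV //; near: y.
rewrite d1 -/dg => /(congr1 (mulmx (invmx (f x)))).
rewrite mulmxDr mulKmx // mulmx0 mulmxA => /eqP.
by rewrite addrC addr_eq0 => /eqP.
Unshelve. all: by end_near. Qed.

Lemma differentiable_mxP m n (f : V -> 'M[R]_(m, n)) x :
  differentiable f x <-> forall i j, differentiable (fun y => f y i j) x.
Proof.
split=> [fx i j|fx].
  exact: (differentiable_comp fx (differentiable_coord _ i j)).
(* A matrix is the sum of its entries times elementary matrices, so differentiability passes from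
   the entries to [f]. *)
rewrite (_ : f = \sum_i \sum_j fun y => f y i j *: delta_mx i j).
  apply: differentiable_sum => i; apply: differentiable_sum => j.
  exact: differentiableZl.
apply/funext => y; rewrite {1}[f y]matrix_sum_delta fct_sumE.
by apply: eq_bigr => i _; rewrite fct_sumE.
Qed.

Lemma differentiable_mulmx m n p (f : V -> 'M[R]_(m, n))
    (g : V -> 'M[R]_(n, p)) x :
  differentiable f x -> differentiable g x ->
  differentiable (fun y => f y *m g y) x.
Proof.
move=> /differentiable_mxP fx /differentiable_mxP gx.
apply/differentiable_mxP => i j.
rewrite (_ : (fun _ => _) = \sum_k (fun y => f y i k * g y k j)).
  by apply: differentiable_sum => k; exact: differentiableM.
by apply/funext => y; rewrite mxE fct_sumE.
Qed.

End MatrixCalculus.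

(** * Positive matrices, their eigenvalues and traces *)

Section PositiveMatrices.
Context {R : realType}.

(** Symmetry is not part of this notion; lemmas that use it assume it separately. *)
Definition posemidef n (M : 'M[R]_n) :=
  forall u : 'cV[R]_n, 0 <= (u^T *m M *m u) 0 0.

Lemma posdef_semidef n (M : 'M[R]_n) : posdef M -> posemidef M.
Proof.
move=> [_ Mpos] u; have [->|u0] := eqVneq u 0; last exact/ltW/Mpos.
by rewrite mulmx0 mxE.
Qed.

(** The form vanishes at the transpose of any row in the left kernel of [M], so that row is zero. *)
Lemma posdef_unitmx n (M : 'M[R]_n) : posdef M -> M \in unitmx.
Proof.
move=> [Msym Mpos]; rewrite -row_free_unit -kermx_eq0.
apply/eqP/row_matrixP => i; rewrite row0; set v := row i _.
have vM0 : v *m M = 0 by rewrite -row_mul mulmx_ker row0.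
apply: contrapT => /eqP v0.
have := Mpos v^T; rewrite trmxK vM0 mul0mx mxE ltxx.
by move=> /(_ _)/notF; apply; rewrite -trmx0 (inj_eq trmx_inj).
Qed.

Lemma posdef_inv n (M : 'M[R]_n) : posdef M -> posdef (invmx M).
Proof.
move=> Mpd; have Mu := posdef_unitmx Mpd; have [Msym Mpos] := Mpd.
rewrite /symmetric_mx /= in Msym.
split=> [|u u0]; first by rewrite /symmetric_mx /= trmx_inv Msym.
have -> : u^T *m invmx M *m u = (invmx M *m u)^T *m M *m (invmx M *m u).
  by rewrite trmx_mul trmx_inv Msym -!mulmxA mulKVmx.
apply: Mpos; apply: contra_neq u0 => /(congr1 (mulmx M)).
by rewrite mulKVmx // mulmx0.
Qed.

(** Induction on the size: the first row and column are split off, and the Schur complement of the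
    corner entry is again positive definite. *)
Lemma cholesky n (M : 'M[R]_n) : posdef M -> exists B : 'M[R]_n, M = B^T *m B.
Proof.
elim: n M => [M _|n IH].
  by exists 0; apply/matrixP => -[].
rewrite -[n.+1]/(1 + n)%N => M; rewrite -(submxK M).
set b := dlsubmx M; set d := drsubmx M.
rewrite [ulsubmx M]mx11_scalar; set a := ulsubmx M 0 0.
move: (ursubmx M) => b' [].
rewrite /symmetric_mx /= tr_block_mx => /eq_block_mx [_ bb' _ dsym] Mpos.
rewrite -{b'}bb' in Mpos *.
have a0 : 0 < a.
  have := Mpos (col_mx 1%:M 0).
  rewrite tr_col_mx mul_row_block mul_row_col trmx1 trmx0 !mul0mx !mul1mx.
  rewrite mulmx0 !addr0 mulmx1 mxE eqxx; apply.
  rewrite col_mx_eq0 negb_and; apply/orP; left.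
  by apply/eqP => /matrixP/(_ 0 0)/eqP; rewrite !mxE eqxx oner_eq0.
have [w bE] : exists w, b = a *: w.
  by exists (a^-1 *: b); rewrite scalerA divff ?scale1r ?gt_eqF.
(* The Schur complement of [a]: the form of [M] at [(- w^T u, u)] is the form
   of [d - a w w^T] at [u]. *)
have [|E dE] := IH (d - a *: (w *m w^T)).
  split=> [|u u0].
    by rewrite /symmetric_mx /= linearB /= dsym linearZ /= trmx_mul trmxK.
  pose c := (w^T *m u) 0 0.
  have wuE : w^T *m u = c%:M by exact: mx11_scalar.
  have uwE : u^T *m w = c%:M.
    by rewrite -[u^T *m w]trmxK trmx_mul trmxK wuE tr_scalar_mx.
  have := Mpos (col_mx (- c)%:M u).
  rewrite col_mx_eq0 (negbTE u0) andbF => /(_ isT).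
  rewrite bE tr_col_mx mul_row_block mul_row_col tr_scalar_mx.
  rewrite -scalemxAr uwE -scalar_mxM scale_scalar_mx -raddfD mulNr.
  rewrite [a * c]mulrC addNr raddf0 mul0mx.
  rewrite add0r linearZ /= mulmxBr mulmxBl addrC.
  rewrite mulmxDl mul_scalar_mx scaleNr mulNmx -!scalemxAl wuE -!scalemxAr.
  by rewrite -scalemxAl mulmxA uwE mul_scalar_mx -scalemxAl wuE !scalerA mulrC.
(* An upper triangular factor: its Gram matrix has blocks [a], [a w^T], [a w] and [a w w^T + E^T E],
   the last being [d] by the choice of [E]. *)
exists (block_mx (Num.sqrt a)%:M (Num.sqrt a *: w^T) 0 E).
rewrite tr_block_mx mulmx_block !tr_scalar_mx [(_ *: w^T)^T]linearZ /= trmxK.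
rewrite !trmx0 !mul0mx !mulmx0 !addr0 -dE bE.
rewrite -!scalemxAl -!scalemxAr !mul_scalar_mx !mul_mx_scalar !scalerA.
rewrite -expr2 sqr_sqrtr ?ltW // scale_scalar_mx -expr2 sqr_sqrtr ?ltW //.
by rewrite linearZ /= addrC subrK.
Qed.

Lemma sqnormE n (u : 'cV[R]_n) : (u^T *m u) 0 0 = \sum_i u i 0 ^+ 2.
Proof. by rewrite mxE; apply: eq_bigr => i _; rewrite mxE. Qed.

Lemma sqnorm_ge0 n (u : 'cV[R]_n) : 0 <= (u^T *m u) 0 0.
Proof. by rewrite sqnormE; apply: sumr_ge0 => i _; exact: sqr_ge0. Qed.

Lemma sqr_entry_le n (u : 'cV[R]_n) i : u i 0 ^+ 2 <= (u^T *m u) 0 0.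
Proof.
rewrite sqnormE (bigD1 i) //= lerDl.
by apply: sumr_ge0 => j _; exact: sqr_ge0.
Qed.

Lemma sqnorm_eq0 n (u : 'cV[R]_n) : (u^T *m u) 0 0 = 0 -> u = 0.
Proof.
move=> u0; apply/matrixP => i j; rewrite (ord1 j) [RHS]mxE; apply/eqP.
by rewrite -sqrf_eq0 eq_le sqr_ge0 -u0 sqr_entry_le.
Qed.

(** With [w = M v], the form at [v + t w] is [2 t s + t^2 c], where [s] is the squared norm of [w].
    A polynomial in [t] without constant term that is nonnegative everywhere has zero linear
    coefficient. *)
Lemma posemidef_isotropic n (M : 'M[R]_n) (v : 'cV[R]_n) :
  M^T = M -> posemidef M -> (v^T *m M *m v) 0 0 = 0 -> M *m v = 0.
Proof.
move=> Msym Mpos vMv; set w := M *m v.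
have wE : v^T *m M = w^T by rewrite trmx_mul Msym.
pose s := (w^T *m w) 0 0; pose c := (w^T *m M *m w) 0 0.
have c0 : 0 <= c := Mpos w.
have q t : 0 <= t * s *+ 2 + t ^+ 2 * c.
  have -> : t * s *+ 2 + t ^+ 2 * c =
      ((v + t *: w)^T *m M *m (v + t *: w)) 0 0; last exact: Mpos.
  rewrite [(v + _)^T]linearD /= [(t *: w)^T]linearZ /= mulmxDl wE mulmxDl.
  rewrite !mulmxDr -!scalemxAl -!scalemxAr.
  have -> : w^T *m v = 0 by rewrite -wE [LHS]mx11_scalar vMv raddf0.
  rewrite -[w^T *m M *m v]mulmxA -/w add0r scalerA.
  have eD (N N' : 'M[R]_1) : (N + N') 0 0 = N 0 0 + N' 0 0 by rewrite mxE.
  have eZ a (N : 'M[R]_1) : (a *: N) 0 0 = a * N 0 0 by rewrite mxE.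
  by rewrite !(eD, eZ) -/s -/c addrA -expr2 mulr2n.
have s0 : s = 0.
  have s_ge0 : 0 <= s by exact: sqnorm_ge0.
  have c1 : 0 < c + 1 by lra.
  (* The denominator is [c + 1] rather than [c], which may vanish. *)
  have := q (- s / (c + 1)).
  have -> : - s / (c + 1) * s *+ 2 + (- s / (c + 1)) ^+ 2 * c =
    - (s ^+ 2 * (c + 2) / (c + 1) ^+ 2) by field; apply: lt0r_neq0.
  rewrite oppr_ge0 pmulr_lle0 ?invr_gt0 ?exprn_gt0 //.
  rewrite pmulr_lle0; last by lra.
  by move=> h; apply/eqP; rewrite -sqrf_eq0 eq_le h sqr_ge0.
exact: sqnorm_eq0.
Qed.

(** The quadratic form attains its maximum on the compact unit sphere, and a maximizer is an
    eigenvector. The size [n.+1] makes the sphere nonempty; row vectors are used because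
    [eigenvalue] refers to left eigenvectors. *)
Lemma rayleigh n (M : 'M[R]_n.+1) : M^T = M ->
  exists2 a, eigenvalue M a & posemidef (a%:M - M).
Proof.
move=> Msym.
pose nrm (u : 'rV[R]_n.+1) := (u *m u^T) 0 0.
pose q (u : 'rV[R]_n.+1) := (u *m M *m u^T) 0 0.
have nrmE u : nrm u = (u^T^T *m u^T) 0 0 by rewrite trmxK.
have dtr u : differentiable (fun v : 'rV[R]_n.+1 => v^T) u.
  apply/differentiable_mxP => i j; under eq_fun do rewrite mxE.
  exact: differentiable_coord.
have cnrm : continuous nrm.
  move=> u; apply/differentiable_continuous.
  apply: (differentiable_mxP (fun v => v *m v^T) u).1.
  exact: differentiable_mulmx.
have cq : continuous q.
  move=> u; apply/differentiable_continuous.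
  apply: (differentiable_mxP (fun v => v *m M *m v^T) u).1.
  by apply: differentiable_mulmx => //; exact: differentiable_mulmx.
pose S := [set u | nrm u = 1].
have S0 : S !=set0.
  by exists (delta_mx 0 0); rewrite /S /= /nrm trmx_delta mul_delta_mx mxE.
have Scpt : compact S.
  (* The norm on matrices is the maximum norm, whereas [S] is the Euclidean sphere; an entry of a
     Euclidean unit vector has absolute value at most 1. *)
  apply: bounded_closed_compact.
    exists 1; split=> // x x1 u Su /=; apply: le_trans (ltW x1).
    rewrite /Num.norm /= mx_normrE; apply: bigmax_le => // -[i j] _ /=.
    rewrite (ord1 i) -(expr_le1 (n := 2)) // real_normK ?num_real //.
    by have := sqr_entry_le u^T j; rewrite -nrmE Su mxE.
  apply: (preimage_closed (f := nrm) (D := [set 1])) => [u _|]; first exact: cnrm.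
  exact: closed_eq.
have [v /set_mem Sv vmax] := compact_EVT_max S0 Scpt (continuous_subspaceT cq).
rewrite /S /= in Sv.
have v0 : v != 0.
  by apply: contra_eq_neq Sv => ->; rewrite /nrm mul0mx mxE eq_sym oner_neq0.
(* Homogeneity extends the bound from the sphere to all vectors. *)
have qle u : q u <= q v * nrm u.
  have [->|u0] := eqVneq u 0; first by rewrite /q /nrm !mul0mx !mxE mulr0.
  have nu0 : 0 < nrm u.
    rewrite lt_neqAle nrmE sqnorm_ge0 andbT eq_sym.
    by apply: contra_neq u0 => /sqnorm_eq0/(congr1 trmx); rewrite trmxK trmx0.
  pose k := (Num.sqrt (nrm u))^-1.
  have k2 : k ^+ 2 = (nrm u)^-1 by rewrite exprVn sqr_sqrtr // ltW.
  have := vmax (k *: u).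
  rewrite inE /S /= /q /nrm.
  have -> : (k *: u)^T = k *: u^T by rewrite linearZ.
  rewrite -!scalemxAl -!scalemxAr !scalerA -expr2 k2.
  rewrite [(_ *: (u *m u^T)) 0 0]mxE [(_ *: (u *m M *m u^T)) 0 0]mxE.
  rewrite -/(nrm u) mulVf ?gt_eqF // => /(_ erefl).
  by rewrite mulrC ler_pdivrMr.
have psd : posemidef ((q v)%:M - M).
  move=> u; rewrite mulmxBr mulmxBl mul_mx_scalar -scalemxAl.
  have := qle u^T; rewrite /q /nrm trmxK => h.
  by rewrite mxE [X in X + _]mxE [X in _ + X]mxE subr_ge0.
(* [v] is isotropic for the semidefinite [q v - M], hence in its kernel. *)
exists (q v) => //; apply/eigenvalueP; exists v => //.
have : ((q v)%:M - M) *m v^T = 0.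
  apply: posemidef_isotropic => //.
    by rewrite linearB /= tr_scalar_mx Msym.
  rewrite trmxK mulmxBr mulmxBl mul_mx_scalar -scalemxAl.
  rewrite mxE [X in X + _]mxE [X in _ + X]mxE -/(nrm v) -/(q v) Sv.
  by rewrite mulr1 subrr.
rewrite mulmxBl mul_scalar_mx => /(congr1 trmx)/eqP.
rewrite linearB /= linearZ /= trmx_mul !trmxK Msym trmx0 subr_eq0 eq_sym.
by move/eqP.
Qed.

(** For the eigenvalue [b] given by [rayleigh], both [a - b] and [b - M] are semidefinite. In size
    zero there is no eigenvalue, but the form is an empty sum. *)
Lemma eigenvalue_le_posemidef n (M : 'M[R]_n) a : M^T = M ->
  (forall b, eigenvalue M b -> b <= a) -> posemidef (a%:M - M).
Proof.
case: n M => [|n] M Msym Ma u; first by rewrite mxE big_ord0.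
have [b /Ma ba psd] := rayleigh Msym.
have -> : a%:M - M = (a - b)%:M + (b%:M - M) by rewrite raddfB /= subrKA.
rewrite mulmxDr mulmxDl mul_mx_scalar -scalemxAl mxE addr_ge0 //.
by rewrite mxE mulr_ge0 ?subr_ge0 ?sqnorm_ge0.
Qed.

Lemma eigenvalue_ge_posemidef n (M : 'M[R]_n) a : M^T = M ->
  (forall b, eigenvalue M b -> a <= b) -> posemidef (M - a%:M).
Proof.
move=> Msym Ma; rewrite -[M]opprK addrC -raddfN.
apply: eigenvalue_le_posemidef => [|b]; first by rewrite linearN /= Msym.
move=> /eigenvalueP[v vM v0]; rewrite lerNr; apply: Ma.
by apply/eigenvalueP; exists v => //; rewrite scaleNr -vM mulmxN opprK.
Qed.

(** The diagonal entries are the values of the form of [M] at the columns of [K]. *)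
Lemma mxtrace_congr_ge0 m n (M : 'M[R]_n) (K : 'M[R]_(n, m)) :
  posemidef M -> 0 <= \tr (K^T *m M *m K).
Proof.
move=> Mpos; apply: sumr_ge0 => i _.
suff -> : (K^T *m M *m K) i i = ((col i K)^T *m M *m col i K) 0 0.
  exact: Mpos.
rewrite tr_col -row_mul [LHS]mxE [RHS]mxE; apply: eq_bigr => j _.
by rewrite !mxE.
Qed.

(** Writing [Q = B^T B], cyclicity of the trace gives the trace of the congruence of [M] by
    [K B^T]. *)
Lemma mxtrace_posemidef_posdef_ge0 m n (M : 'M[R]_n) (Q : 'M[R]_m)
    (K : 'M[R]_(n, m)) :
  posemidef M -> posdef Q -> 0 <= \tr (M *m (K *m Q *m K^T)).
Proof.
move=> Mpos /cholesky[B ->].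
have := mxtrace_congr_ge0 (K *m B^T) Mpos.
by rewrite trmx_mul trmxK -mulmxA mxtrace_mulC !mulmxA.
Qed.

(** With [E] the inverse, the form at [u] is the squared norm of [H^T E u]. *)
Lemma posemidef_invmx_gram p q (H : 'M[R]_(p, q)) :
  H *m H^T \in unitmx -> posemidef (invmx (H *m H^T)).
Proof.
move=> Hu u; set E := invmx _.
have -> : u^T *m E *m u = (H^T *m (E *m u))^T *m (H^T *m (E *m u)).
  have Esym : E^T = E by rewrite trmx_inv trmx_mul trmxK.
  rewrite trmx_mul trmx_mul trmxK Esym !mulmxA.
  by rewrite -[u^T *m E *m H *m H^T]mulmxA mulmxKV.
exact: sqnorm_ge0.
Qed.

Lemma posemidef_congr m n (M : 'M[R]_n) (K : 'M[R]_(n, m)) :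
  posemidef M -> posemidef (K^T *m M *m K).
Proof.
by move=> Mpos u; have := Mpos (K *m u); rewrite trmx_mul !mulmxA.
Qed.

Lemma mxtraceN n (M : 'M[R]_n) : \tr (- M) = - \tr M.
Proof. exact: raddfN. Qed.

(** The left side is what the product rule gives for Tr(QDQD). After [P] is eliminated from [dQ],
    that factor contributes [+ Tr(S DQD)] while [dD] contributes [- 2 Tr(S DQD)], so one negative
    copy survives. *)
Lemma mxtrace_riccati n (A A' W S P D Q dP dQ dD : 'M[R]_n) :
  Q *m P = 1%:M -> P *m Q = 1%:M ->
  dP = A *m P + P *m A' + W - P *m S *m P ->
  dQ = - (Q *m dP *m Q) ->
  dD = A *m D + D *m A' - (D *m S *m P + P *m S *m D) ->
  \tr (((dQ *m D + Q *m dD) *m Q + Q *m D *m dQ) *m D + Q *m D *m Q *m dD)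
  = - (\tr (W *m (Q *m D *m Q *m D *m Q)) + \tr (S *m (D *m Q *m D))) *+ 2.
Proof.
move=> QP PQ dPE dQE dDE.
have {dPE}dQE : dQ = - (Q *m A + A' *m Q + Q *m W *m Q - S).
  rewrite dQE dPE !mulmxDr !mulmxDl mulmxN mulNmx !mulmxA QP !mul1mx.
  by rewrite -[Q *m A *m P *m Q]mulmxA PQ mulmx1 -[S *m P *m Q]mulmxA PQ mulmx1.
(* By cyclicity the two occurrences of [Q], and likewise those of [D], contribute equally. *)
pose N := \tr (dQ *m D *m Q *m D) + \tr (Q *m dD *m Q *m D).
have -> : \tr (((dQ *m D + Q *m dD) *m Q + Q *m D *m dQ) *m D +
    Q *m D *m Q *m dD) = N *+ 2.
  rewrite !mulmxDl !mxtraceD -/N -addrA mulr2n; congr (_ + _).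
  rewrite -[_ *m dQ *m _]mulmxA mxtrace_mulC mulmxA; congr (_ + _).
  by rewrite -[_ *m Q *m dD]mulmxA mxtrace_mulC !mulmxA.
congr (_ *+ 2).
have dQtr : \tr (dQ *m D *m Q *m D) =
  - (\tr (Q *m A *m D *m Q *m D) + \tr (A' *m Q *m D *m Q *m D) +
     \tr (Q *m W *m Q *m D *m Q *m D) - \tr (S *m D *m Q *m D)).
  by rewrite dQE !mulNmx !mulmxDl !mulNmx mxtraceN !mxtraceD mxtraceN.
have dDtr : \tr (Q *m dD *m Q *m D) =
   \tr (Q *m A *m D *m Q *m D) + \tr (A' *m Q *m D *m Q *m D) -
   (\tr (S *m D *m Q *m D) + \tr (S *m D *m Q *m D)).
  rewrite dDE !mulmxDr mulmxN mulmxDr !mulmxDl mulNmx mulmxDl.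
  rewrite mulNmx mulmxDl mxtraceD mxtraceN !mxtraceD !mulmxA QP mul1mx.
  congr (_ + _ - (_ + _)).
    by rewrite -[_ *m Q *m D]mulmxA -[_ *m A' *m _]mulmxA mxtrace_mulC !mulmxA.
  rewrite -[_ *m P *m Q]mulmxA PQ mulmx1 -[_ *m S *m D]mulmxA mxtrace_mulC.
  by rewrite !mulmxA.
rewrite /N dQtr dDtr.
have -> : \tr (Q *m W *m Q *m D *m Q *m D) =
    \tr (W *m (Q *m D *m Q *m D *m Q)).
  by rewrite -!mulmxA mxtrace_mulC !mulmxA.
by rewrite !mulmxA; ring.
Qed.

Lemma natural_metric_rate n (P W D : 'M[R]_n) (mu pmax : R) : 0 <= mu ->
  posdef P -> D^T = D -> posemidef (pmax%:M - P) -> posemidef (W - mu%:M) ->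
  mu / pmax * natural_metric P D D <=
    \tr (W *m (invmx P *m D *m invmx P *m D *m invmx P)).
Proof.
(* In size zero the sign of [pmax] is unknown, but both sides are empty sums. In positive size, the
   form of [P] at a basis vector forces [pmax > 0]. *)
case: n P W D => [|n] P W D mu0 Ppd Dsym Ppm Wmu.
  by rewrite /natural_metric /mxtrace !big_ord0 mulr0.
have Qpd := posdef_inv Ppd; have Pu := posdef_unitmx Ppd.
set Q := invmx P in Qpd *.
have pmax0 : 0 < pmax.
  pose u : 'cV[R]_n.+1 := delta_mx 0 0.
  have u0 : u != 0.
    apply/eqP => /matrixP/(_ 0 0)/eqP; rewrite !mxE !eqxx.
    exact/negP/oner_neq0.
  have uP : 0 < (u^T *m P *m u) 0 0 by case: Ppd => _; apply.
  have := Ppm u; rewrite mulmxBr mulmxBl mul_mx_scalar -scalemxAl.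
  rewrite [u^T *m u](_ : _ = 1%:M); last first.
    rewrite trmx_delta mul_delta_mx; apply/matrixP => i j.
    by rewrite !ord1 !mxE.
  rewrite scale_scalar_mx mulr1 mxE [X in X + _]mxE [X in _ + X]mxE eqxx.
  by rewrite subr_ge0; exact: lt_le_trans.
set X := Q *m D *m Q *m D *m Q.
have XE : X = (Q *m D) *m Q *m (Q *m D)^T.
  have Qsym : Q^T = Q by case: Qpd.
  by rewrite trmx_mul Dsym Qsym /X !mulmxA.
have WX : mu * \tr X <= \tr (W *m X).
  have := mxtrace_posemidef_posdef_ge0 (Q *m D) Wmu Qpd.
  by rewrite -XE mulmxBl mul_scalar_mx mxtraceD mxtraceN mxtraceZ subr_ge0.
have PX : natural_metric P D D <= pmax * \tr X.
  have := mxtrace_posemidef_posdef_ge0 (Q *m D) Ppm Qpd.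
  rewrite -XE mulmxBl mul_scalar_mx mxtraceD mxtraceN mxtraceZ subr_ge0.
  by rewrite /X !mulmxA mulmxV // mul1mx mxtrace_mulC /natural_metric !mulmxA.
apply: le_trans WX; rewrite -mulrA ler_wpM2l // mulrC ler_pdivrMr // mulrC.
exact: PX.
Qed.

End PositiveMatrices.

(** * The Riccati flow and its linearization *)

Section RiccatiContraction.
Context {R : realType} {n m p q : nat}.
Context (A : R -> 'M[R]_n) (G : R -> 'M[R]_(n, m))
    (C : R -> 'M[R]_(p, n)) (H : R -> 'M[R]_(p, q)).

Lemma diff_riccati t (P D : 'M[R]_n) :
  let S := (C t)^T *m invmx (H t *m (H t)^T) *m C t in
  'd (riccati A G C H t) P D =
  A t *m D + D *m (A t)^T - (D *m S *m P + P *m S *m D).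
Proof.
move=> S.
have -> : riccati A G C H t = (fun P => A t *m P) + (fun P => P *m (A t)^T) +
    cst (G t *m (G t)^T) - (fun P => P *m S *m P).
  by apply/funext => X; rewrite !fctE /riccati /S !mulmxA.
have dS : differentiable (fun X : 'M[R]_n => X *m S) P.
  exact: differentiable_mulmx.
have dl : differentiable (fun X : 'M[R]_n => A t *m X) P.
  exact: differentiable_mulmx.
have dr : differentiable (fun X : 'M[R]_n => X *m (A t)^T) P.
  exact: differentiable_mulmx.
have dq : differentiable (fun X : 'M[R]_n => X *m S *m X) P.
  exact: differentiable_mulmx.
have dG : differentiable (cst (G t *m (G t)^T) : 'M[R]_n -> 'M[R]_n) P.
  exact: differentiable_cst.
(* Once differentiability is known, the differential at [D] is the directional derivative, to which
   the product rules apply. *)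
rewrite -deriveE; last first.
  exact: (differentiableB (differentiableD (differentiableD dl dr) dG) dq).
have iD := is_derive_id P D.
have iC (M : 'M[R]_n) := is_derive_cst M P D.
have := is_deriveB (is_deriveD (is_deriveD (is_derive_mulmx (iC (A t)) iD)
  (is_derive_mulmx iD (iC (A t)^T))) (iC (G t *m (G t)^T)))
  (is_derive_mulmx (is_derive_mulmx iD (iC S)) iD).
move=> /(@derive_val _ _ _ _ _ _ _) ->.
by rewrite !(mul0mx, mulmx0) add0r !addr0.
Qed.

(** Contraction at a given rate is reduced to a bound on the term in [G] alone, the term in [C] and
    [H] having the right sign. It serves for both the rate 0 and the rate [mu / pmax]. *)
Lemma contracts_riccati lambda J P dP t :
  open J -> solution_on posdef (riccati A G C H) J P ->
  linearized_solution_on symmetric_mx (riccati A G C H) J P dP -> J t ->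
  H t *m (H t)^T \in unitmx ->
  lambda * natural_metric (P t) (dP t) (dP t) <=
    \tr (G t *m (G t)^T *m (invmx (P t) *m dP t *m invmx (P t) *m dP t *m
      invmx (P t))) ->
  contracts_at natural_metric lambda P dP t.
Proof.
move=> Jo solP solD Jt Hu lam.
have [Ppd dPt] := solP _ Jt; have [Dsym dDt] := solD _ Jt.
(* Openness of [J] keeps [P s] positive definite for all [s] near [t], as differentiating the
   inverse requires. *)
have Punit : \forall s \near t, P s \in unitmx.
  near=> s; apply: posdef_unitmx; suff /solP[] : J s by [].
  by near: s; exact: open_nbhs_nbhs.
have dQt := is_derive_invmx Punit dPt.
have de : is_derive t 1 (fun s => natural_metric (P s) (dP s) (dP s)) _ :=
  is_derive_mxtrace (is_derive_mulmx (is_derive_mulmx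
    (is_derive_mulmx dQt dDt) dQt) dDt).
have Pu := nbhs_singleton Punit.
pose S := (C t)^T *m invmx (H t *m (H t)^T) *m C t.
have S0 : 0 <= \tr (S *m (dP t *m invmx (P t) *m (dP t)^T)).
  apply: mxtrace_posemidef_posdef_ge0; last exact: posdef_inv.
  exact/posemidef_congr/posemidef_invmx_gram.
rewrite /symmetric_mx /= in Dsym; rewrite Dsym in S0.
have [ex_de val_de] := de; split; first exact: ex_de.
rewrite derive1E [X in X <= _]val_de.
rewrite (mxtrace_riccati (mulVmx Pu) (mulmxV Pu) (A := A t) (A' := (A t)^T)
  (W := G t *m (G t)^T) (S := S) _ erefl (diff_riccati _ _ _)); last first.
  by rewrite /riccati /S !mulmxA.
rewrite mulNr -mulrA mulNrn lerN2 -[leRHS]mulr_natl ler_pM2l //.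
by apply: le_trans lam _; rewrite lerDl.
Unshelve. all: by end_near. Qed.

End RiccatiContraction.

Theorem lemma1 (R : realType) (n m p q : nat)
    (A : R -> 'M[R]_n) (G : R -> 'M[R]_(n, m))
    (C : R -> 'M[R]_(p, n)) (H : R -> 'M[R]_(p, q))
    (smoothA : smooth A) (smoothG : smooth G)
    (smoothC : smooth C) (smoothH : smooth H)
    (unitA : forall t, A t \in unitmx)
    (unitHH : forall t, H t *m (H t)^T \in unitmx)
    (posGG : forall t, posdef (G t *m (G t)^T)) :
  contraction_on posdef symmetric_mx (riccati A G C H) natural_metric posdef /\
  forall (mu pmax : R), 0 < mu ->
  forall (J : set R) (P dP : R -> 'M[R]_n),
    open J -> is_interval J ->
    solution_on posdef (riccati A G C H) J P ->
    linearized_solution_on symmetric_mx (riccati A G C H) J P dP ->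
    forall t, J t ->
      (forall a, eigenvalue (P t) a -> a <= pmax) ->
      (forall a, eigenvalue (G t *m (G t)^T) a -> mu <= a) ->
      contracts_at natural_metric (mu / pmax) P dP t.
Proof.
split=> [|mu pmax mu0 J P dP Jo _ solP solD t Jt Ple Gge].
  (* One rate has to serve on the whole cone; with rate 0 it remains to see that the trace with
     [G G^T] is nonnegative. *)
  exists 0 => // J P dP Jo _ solP solD t Jt _.
  apply: (contracts_riccati Jo solP solD Jt (unitHH t)).
  have [/posdef_inv Qpd _] := solP _ Jt; have [Dsym _] := solD _ Jt.
  have := mxtrace_posemidef_posdef_ge0 (invmx (P t) *m dP t)
    (posdef_semidef (posGG t)) Qpd.
  have Qsym : (invmx (P t))^T = invmx (P t) by case: Qpd.
  by rewrite mul0r trmx_mul Qsym Dsym !mulmxA.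
have [Ppd _] := solP _ Jt; have [Dsym _] := solD _ Jt.
apply: (contracts_riccati Jo solP solD Jt (unitHH t)).
apply: natural_metric_rate => //; first exact: ltW.
  by apply: eigenvalue_le_posemidef => //; case: Ppd.
by apply: eigenvalue_ge_posemidef => //; case: (posGG t).
Qed.
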